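(* Let $n\ge2$, let $(X,F)$ be a symmetric $n$-ary band with associated binary band $(X,B)$, and let $\sigma$ be the least semilattice congruence on $(X,B)$. Let $F^\sigma$ and $B^\sigma$ be the operations induced on $X/\sigma$ by $F$ and $B$. Then the pair $(X/\sigma,F^\sigma)$ is a symmetric $n$-ary band. Moreover, $B_{F^\sigma}=B^\sigma$, where $B_{F^\sigma}$ is the binary operation associated with $F^\sigma$. In particular, $(X/\sigma,F^\sigma)$ is the $n$-ary extension of the semilattice $(X/\sigma,B^\sigma)$.
   Context: An operation $F\colon X^n\to X$ ($X$ nonempty) is associative if $F(x_1,\ldots,x_{i-1},F(x_i,\ldots,x_{i+n-1}),x_{i+n},\ldots,x_{2n-1})=F(x_1,\ldots,x_i,F(x_{i+1},\ldots,x_{i+n}),x_{i+n+1},\ldots,x_{2n-1})$ for all $x_1,\ldots,x_{2n-1}\in X$ and $1\le i\le n-1$. A symmetric $n$-ary band is a pair $(X,F)$ with $F$ associative, invariant under permutations of its arguments, and idempotent ($F(x,\ldots,x)=x$ for all $x$). The binary operation associated with an $n$-ary operation $F$ is $B_F(x,y)=F(x,\ldots,x,y)$, with $x$ repeated $n-1$ times; we write $B=B_F$. For a symmetric $n$-ary band, $(X,B)$ is a right normal band, i.e. an idempotent semigroup with $B(B(x,y),z)=B(B(y,x),z)$ for all $x,y,z$. A semilattice is a commutative idempotent semigroup. A semilattice congruence on $(X,B)$ is a congruence whose quotient is a semilattice. The least one, $\sigma$, is given (because $(X,B)$ is a right normal band) by: $x\,\sigma\,y$ if and only if $B(y,x)=x$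 and $B(x,y)=y$. The relation $\sigma$ is also a congruence for $F$ (compatible with $F$), so $F^\sigma([x_1],\ldots,[x_n])=[F(x_1,\ldots,x_n)]$ and $B^\sigma([x_1],[x_2])=[B(x_1,x_2)]$ are well defined, $[x]$ denoting the $\sigma$-class of $x$. The $n$-ary extension of a semigroup $(S,\ast)$ is $(S,H)$ with $H(s_1,\ldots,s_n)=s_1\ast\cdots\ast s_n$. *)

(* Defs.v *)
From mathcomp Require Import all_boot perm boolp.

Set Implicit Arguments.
Unset Strict Implicit.
Unset Printing Implicit Defensive.

Local Open Scope quotient_scope.

Section NaryOperations.
Variables (X : Type) (n : nat).
Implicit Type F : n.-tuple X -> X.

(* [nested F x i] is F (x_0, .., x_(i-1), F (x_i, .., x_(i+n-1)), x_(i+n), ..,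
   x_(2n-2)), for i < n: the arguments are numbered from 0, and only the first
   2n - 1 values of the sequence x are used. *)
Definition nested F (x : nat -> X) (i : nat) : X :=
  F [tuple if j < i then x j
           else if j == i :> nat then F [tuple x (i + k) | k < n]
           else x (j + n.-1) | j < n].

Definition nary_associative F :=
  forall (x : nat -> X) (i : nat), i.+1 < n -> nested F x i = nested F x i.+1.

Definition nary_symmetric F :=
  forall (p : 'S_n) (t : n.-tuple X), F [tuple tnth t (p i) | i < n] = F t.

Definition nary_idempotent F := forall x : X, F [tuple x | i < n] = x.

Definition symmetric_nary_band F :=
  [/\ inhabited X, nary_associative F, nary_symmetric F & nary_idempotent F].

Definition assoc_binop F (x y : X) : X :=
  F [tuple if i < n.-1 then x else y | i < n].

(* The product of a nonempty tuple is taken without a unit element, as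
   (.. (s * t_0) * ..) * t_(n-2). *)
Definition nary_extension (op : X -> X -> X) F :=
  forall (s : X) (t : seq X) (sz : size (s :: t) == n),
    F (Tuple sz) = foldl op s t.

End NaryOperations.

Definition semilattice (S : Type) (op : S -> S -> S) :=
  [/\ associative op, commutative op & idempotent_op op].

(* [{eq_quot e}] needs a choiceType; [{classic X}] is X itself, with the
   classical choice structure. *)
Definition quot (X : Type) (R : equiv_rel X) : eqQuotType R :=
  {eq_quot (R : equiv_rel {classic X})}.

Section InducedOperations.
Variables (X : Type) (R : equiv_rel X).

Definition induced_nary n (F : n.-tuple X -> X)
    (t : n.-tuple (quot R)) : quot R :=
  \pi_(quot R) (F (map_tuple repr t)).

Definition induced_binop (B : X -> X -> X) (a b : quot R) : quot R :=
  \pi_(quot R) (B (repr a) (repr b)).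

Definition nary_congruence n (F : n.-tuple X -> X) :=
  forall s t : n.-tuple X, (forall i, R (tnth s i) (tnth t i)) -> R (F s) (F t).

Definition congruence (B : X -> X -> X) :=
  forall x x' y y' : X, R x x' -> R y y' -> R (B x y) (B x' y').

Lemma quotP (x y : X) :
  reflect (\pi_(quot R) x = \pi_(quot R) y) (R x y).
Proof. exact: eqquotP. Qed.

Lemma repr_quot (x : X) : R (repr (\pi_(quot R) x)) x.
Proof. by apply/quotP; rewrite reprK. Qed.

(* For congruences the choice of representatives is irrelevant. *)
Lemma induced_naryE n (F : n.-tuple X -> X) : nary_congruence F ->
  forall t : n.-tuple X,
    induced_nary F (map_tuple \pi_(quot R) t) = \pi_(quot R) (F t).
Proof.
move=> RF t; apply/quotP/RF => i.
by rewrite !tnth_map; apply: repr_quot.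
Qed.

Lemma induced_binopE (B : X -> X -> X) : congruence B ->
  forall x y : X,
    induced_binop B (\pi_(quot R) x) (\pi_(quot R) y)
      = \pi_(quot R) (B x y).
Proof. by move=> RB x y; apply/quotP/RB; apply: repr_quot. Qed.

Definition semilattice_congruence (B : X -> X -> X) :=
  congruence B /\ semilattice (induced_binop B).

End InducedOperations.

Definition least_semilattice_congruence (X : Type) (B : X -> X -> X)
    (sigma : equiv_rel X) :=
  semilattice_congruence sigma B /\
  forall R : equiv_rel X, semilattice_congruence R B ->
    forall x y : X, sigma x y -> R x y.

(* Main.v *)
Require Import Defs.
From mathcomp Require Import all_boot perm boolp zify.

Set Implicit Arguments.
Unset Strict Implicit.
Unset Printing Implicit Defensive.

(** The product x_1 * ... * x_n of classes in the semilattice X/R, where R is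
    any semilattice congruence on (X, B), is the class of F(x_1, .., x_n)
    ([pi_nary_op]); all the claims follow from this.

    To see it, work with words.  Associativity and symmetry give every word
    whose length is 1 modulo n - 1 a value that depends neither on the order of
    the letters nor on the way in which applications of F are nested; so one may
    compute as in a commutative semigroup, in which F is the n-fold product and
    B(x, y) = x^(n-1) y.  Put z = F(x_1, .., x_n) = x_1 ... x_n.  By idempotency
    x_1^n = x_1, hence

      B(x_1, z) = x_1^(n-1) x_1 x_2 ... x_n = z,

    and the class of z lies below that of x_1 in the semilattice order.  On the
    other hand z^(n-1) y = x_1^(n-1) ... x_n^(n-1) y, that is,

      B(z, y) = B(x_n, .. B(x_2, B(x_1, y)) .. ).

    With y = x_1 this says that [z] * [x_1] = [x_1] * ... * [x_n], whose left
    side is [z] by the first identity.  These two identities are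
    [assoc_binop_absorb] and [assoc_binop_foldl].

    It follows that R is compatible with F, because the right side of
    [F(x_1, .., x_n)] = [x_1] * ... * [x_n] only depends on the classes of the
    arguments.  So the n-ary laws of F pass to the quotient. *)

(** * Functions of words that ignore the order of the letters *)

(** It is enough to test adjacent transpositions, and only on words of a fixed
    length, which matters for operations that are only meaningful on words of
    suitable length.  A prefix u of letters already in place is carried along:
    the first remaining letter of s is moved to the front of the remaining part
    of t and then joins u. *)
Lemma perm_invariant (T : eqType) (U : Type) (N : nat) (g : seq T -> U) :
    (forall u a b v, size (u ++ a :: b :: v) = N ->
       g (u ++ a :: b :: v) = g (u ++ b :: a :: v)) ->
  forall s t, size s = N -> perm_eq s t -> g s = g t.
Proof.
move=> swap.
have front u t1 a t2 : size (u ++ t1 ++ a :: t2) = N ->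
    g (u ++ t1 ++ a :: t2) = g (u ++ a :: t1 ++ t2).
  elim/last_ind: t1 t2 => [|t1 b IH] t2 //= sz.
  have sz' : size ((u ++ t1) ++ b :: a :: t2) = N.
    by rewrite -sz cat_rcons catA.
  rewrite cat_rcons catA swap // -catA IH ?cat_rcons //.
  by rewrite -sz' !size_cat /= !addnS addnA.
suff gen u s t : size (u ++ s) = N -> perm_eq s t -> g (u ++ s) = g (u ++ t).
  by move=> s t sz st; apply: (gen [::]).
elim: s u t => [|a s IH] u t sz st.
  by move: st; rewrite perm_sym => /perm_nilP ->.
have a_t : a \in t by rewrite -(perm_mem st) mem_head.
case: (splitPr a_t) st => t1 t2 st.
have st' : perm_eq s (t1 ++ t2).
  by rewrite -(perm_cons a) (perm_trans st) // perm_catC /= perm_cons perm_catC.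
rewrite front; last by rewrite -sz !size_cat (perm_size st) size_cat.
by rewrite -!(cat_rcons a u) (IH _ (t1 ++ t2)) // cat_rcons.
Qed.

(** * Values of words under an n-ary operation *)

Section Words.
Variables (X : eqType) (n : nat) (F : n.-tuple X -> X) (x0 : X).
Hypotheses (n_gt1 : 1 < n) (Fassoc : nary_associative F).
Hypotheses (Fsym : nary_symmetric F) (Fidem : nary_idempotent F).

Let n_gt0 : 0 < n := ltnW n_gt1.

(** F as a function of sequences, so that arguments can be concatenated and
    permuted without casts between tuple types; x0 pads sequences that are too
    short. *)
Definition seq_op (s : seq X) : X := F [tuple nth x0 s i | i < n].

Lemma seq_op_tuple (t : n.-tuple X) : seq_op t = F t.
Proof.
by congr F; apply: eq_from_tnth => i; rewrite tnth_mktuple (tnth_nth x0).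
Qed.

Lemma seq_op_perm s t : size s = n -> perm_eq s t -> seq_op s = seq_op t.
Proof.
move=> /eqP sz; have szt p : perm_eq s p -> size p == n.
  by move/perm_size <-.
move=> st; rewrite -[s]/(val (Tuple sz)) -[t]/(val (Tuple (szt _ st))).
rewrite !seq_op_tuple.
have/tuple_permP[p sp] : perm_eq s (Tuple (szt _ st)) by [].
by rewrite -(Fsym p (Tuple (szt _ st))); congr F; apply: val_inj.
Qed.

Lemma seq_op_nseq a : seq_op (nseq n a) = a.
Proof.
rewrite -[RHS](Fidem a); congr F; apply: eq_from_tnth => i.
by rewrite !tnth_mktuple nth_nseq ltn_ord.
Qed.

Lemma assoc_binop_seq_op a b : assoc_binop F a b = seq_op (rcons (nseq n.-1 a) b).
Proof.
congr F; apply: eq_from_tnth => i; rewrite !tnth_mktuple nth_rcons.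
rewrite size_nseq nth_nseq.
case: ltnP => // le; suff -> : (i : nat) = n.-1 by rewrite eqxx.
by apply/eqP; rewrite eqn_leq le andbT -ltnS (prednK n_gt0).
Qed.

(** The instance i = 0 of associativity.  Together with symmetry it suffices:
    it moves a letter across the boundary of the inner application. *)
Lemma seq_op_shift c m b u : size m = n.-1 -> size u = n.-2 ->
  seq_op (seq_op (c :: m) :: b :: u) = seq_op (c :: seq_op (rcons m b) :: u).
Proof.
move=> szm szu; set x := nth x0 (c :: m ++ b :: u).
have E0 : F [tuple x (0 + k) | k < n] = seq_op (c :: m).
  congr F; apply: eq_from_tnth => k; rewrite !tnth_mktuple /x add0n -cat_cons.
  by rewrite nth_cat /= szm (prednK n_gt0) ltn_ord.
have E1 : F [tuple x (1 + k) | k < n] = seq_op (rcons m b).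
  congr F; apply: eq_from_tnth => k; rewrite !tnth_mktuple /x /= nth_cat nth_rcons.
  rewrite szm; case: ltngtP => // [lt | ->]; last by rewrite subnn.
  by have := ltn_ord k; lia.
transitivity (nested F x 0).
  congr F; apply: eq_from_tnth => j; rewrite !tnth_mktuple ltn0 E0.
  case: (nat_of_ord j) => [|k] //=.
  by rewrite /x addSn /= nth_cat szm ltnNge leq_addl addnK.
rewrite (Fassoc _ n_gt1); congr F; apply: eq_from_tnth => j.
rewrite !tnth_mktuple E1; case: (nat_of_ord j) => [|[|k]] //=.
by rewrite /x !addSn /= nth_cat szm -addSn ltnNge leq_addl addnK.
Qed.

(** The value of a word of length k (n - 1) + 1, obtained by k applications of
    the operation nested to the left. *)
Fixpoint iter_op (k : nat) (s : seq X) : X :=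
  if k is k'.+1 then iter_op k' (seq_op (take n s) :: drop n s) else head x0 s.

Lemma iter_op_cat k s v : size s = n ->
  iter_op k.+1 (s ++ v) = iter_op k (seq_op s :: v).
Proof. by move=> sz /=; rewrite take_size_cat ?drop_size_cat. Qed.

Arguments iter_op : simpl never.

(** Carry out the applications that lie entirely before the two letters.  Then
    either both are in the innermost application, whose symmetry exchanges them,
    or they are separated by its end, and associativity moves this end. *)
Lemma iter_op_swap k u a b v : size (u ++ a :: b :: v) = (k * n.-1).+1 ->
  iter_op k (u ++ a :: b :: v) = iter_op k (u ++ b :: a :: v).
Proof.
elim: k u v => [|k IH] u v; rewrite size_cat => sz; rewrite /= in sz; first by lia.
rewrite mulSn in sz.
have [le_n | lt_n] := leqP n (size u).
  rewrite -(cat_take_drop n u) -!catA !iter_op_cat ?size_takel //.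
  by rewrite -!cat_cons IH // size_cat /= size_drop; lia.
have [szu | ne_u] := eqVneq (size u) n.-1.
  (* The letter a closes the innermost block and b opens the rest: after a
     shift, both are in the same block. *)
  case: k sz {IH} => [|k] sz; first by lia.
  case: u szu sz {lt_n} => [|c u] /= szu sz; first by lia.
  rewrite -(cat_take_drop n.-2 v).
  have szv : size (take n.-2 v) = n.-2 by rewrite size_takel; lia.
  set v1 := take _ v; set v2 := drop _ v.
  have red d e : iter_op k.+2 (c :: u ++ d :: e :: v1 ++ v2) =
      iter_op k (seq_op (c :: seq_op (rcons (rcons u d) e) :: v1) :: v2).
    rewrite -cat_rcons -cat_cons iter_op_cat; last by rewrite /= size_rcons; lia.
    rewrite -!cat_cons iter_op_cat; last by rewrite /= szv; lia.
    by rewrite seq_op_shift // size_rcons; lia.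
  rewrite !red; congr (iter_op k (seq_op (c :: _ :: _) :: _)).
  apply: seq_op_perm; first by rewrite !size_rcons; lia.
  by rewrite -!cats1 -!catA perm_cat2l (perm_catC [:: a] [:: b]).
rewrite -(cat_take_drop (n - (size u).+2) v) -!cat_cons !catA.
have szv : size (take (n - (size u).+2) v) = n - (size u).+2.
  by rewrite size_takel //; move: (k * _) sz => N sz; lia.
rewrite !iter_op_cat ?size_cat /= ?szv; try lia.
congr (iter_op k (_ :: _)); apply: seq_op_perm; first by rewrite size_cat /= szv; lia.
by rewrite perm_cat2l (perm_catCA [:: a] [:: b]).
Qed.

Lemma iter_op_perm k s t : size s = (k * n.-1).+1 -> perm_eq s t ->
  iter_op k s = iter_op k t.
Proof. exact: (perm_invariant (@iter_op_swap k)). Qed.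

Lemma iter_op1 s : size s = n -> iter_op 1 s = seq_op s.
Proof. by move=> sz; rewrite -{1}[s]cats0 iter_op_cat. Qed.

(** Nested applications may be flattened wherever they occur: permuting the
    word brings each of them to the innermost place. *)
Lemma iter_op_nseq k j s v : size s = n -> j + size v = (k * n.-1).+1 ->
  iter_op k (nseq j (seq_op s) ++ v) =
  iter_op (j + k) (flatten (nseq j s) ++ v).
Proof.
move=> szs; elim: j k v => [//|j IH] k v szv.
rewrite [nseq _ _ ++ v]/= -iter_op_cat //.
rewrite (@iter_op_perm _ _ (nseq j (seq_op s) ++ (v ++ s))); first last.
- by rewrite perm_catC -catA.
- by rewrite !size_cat size_nseq szs; lia.
rewrite IH; last by rewrite size_cat szs; lia.
rewrite addnS addSn; apply: iter_op_perm; last by rewrite /= catA perm_catC catA.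
have -> : size (flatten (nseq j s) ++ v ++ s) = j * n + (size v + n).
  by rewrite !size_cat szs size_flatten /shape map_nseq sumn_nseq szs mulnC.
lia.
Qed.

(** * The associated binary operation *)

(** x_1^(n-1) (x_1 x_2 ... x_n) = x_1^n x_2 ... x_n = x_1 x_2 ... x_n. *)
Lemma assoc_binop_absorb a s : size (a :: s) = n ->
  assoc_binop F a (seq_op (a :: s)) = seq_op (a :: s).
Proof.
move=> szs; rewrite assoc_binop_seq_op -iter_op1; last first.
  by rewrite size_rcons size_nseq; lia.
rewrite (@iter_op_perm _ _ (seq_op (a :: s) :: nseq n.-1 a)); first last.
- by rewrite perm_rcons.
- by rewrite size_rcons size_nseq; lia.
rewrite -iter_op_cat // (@iter_op_perm _ _ (nseq n a ++ s)); first last.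
- by rewrite -(prednK n_gt0) /= perm_cons perm_catC.
- by rewrite size_cat szs size_nseq; lia.
by rewrite iter_op_cat ?size_nseq // seq_op_nseq iter_op1.
Qed.

Lemma iter_op_foldl k y s v :
  iter_op (size s + k) (y :: flatten [seq nseq n.-1 a | a <- s] ++ v) =
  iter_op k (foldl (fun b a => assoc_binop F a b) y s :: v).
Proof.
elim: s y => // a s IH y; rewrite [size _ + k]/= addSn [flatten _]/= -catA.
rewrite -[_ :: _]/((y :: nseq n.-1 a) ++ _) iter_op_cat; last first.
  by rewrite /= size_nseq prednK.
rewrite IH /=; congr (iter_op _ (foldl _ _ _ :: _)).
rewrite assoc_binop_seq_op; apply: seq_op_perm; first by rewrite /= size_nseq prednK.
by rewrite perm_sym perm_rcons.
Qed.

Lemma perm_flatten_nseq j (s : seq X) :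
  perm_eq (flatten (nseq j s)) (flatten [seq nseq j a | a <- s]).
Proof.
apply/seq.permP => p; rewrite !count_flatten map_nseq sumn_nseq -map_comp.
by elim: s => //= a s <-; rewrite count_nseq mulnDl.
Qed.

(** (x_1 ... x_n)^(n-1) y = x_1^(n-1) ... x_n^(n-1) y: the same letters in
    another order. *)
Lemma assoc_binop_foldl s y : size s = n ->
  assoc_binop F (seq_op s) y = foldl (fun b a => assoc_binop F a b) y s.
Proof.
move=> szs; rewrite assoc_binop_seq_op -iter_op1; last first.
  by rewrite size_rcons size_nseq prednK.
rewrite -cats1 iter_op_nseq //=; last by rewrite mul1n addn1.
transitivity (iter_op (size s + 0) (y :: flatten [seq nseq n.-1 a | a <- s] ++ [::])).
  rewrite szs addn1 addn0 prednK //; apply: iter_op_perm.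
    by rewrite size_cat size_flatten /shape map_nseq sumn_nseq szs addn1.
  by rewrite cats0 perm_catC perm_cons perm_flatten_nseq.
by rewrite iter_op_foldl.
Qed.

End Words.

(** * The quotient *)

Local Open Scope quotient_scope.

(** In the semilattice order, z = F(x, ..) lies below x because x absorbs z, so
    that [z] is [z] * [x]; the latter is the product of all the arguments, with
    [x] repeated. *)
Lemma pi_nary_op (X : Type) (n : nat) (F : n.-tuple X -> X) (R : equiv_rel X) :
    1 < n -> symmetric_nary_band F ->
    semilattice_congruence R (assoc_binop F) ->
  forall x s (sz : size (x :: s) == n),
    \pi_(quot R) (F (Tuple sz)) =
    foldl (induced_binop (assoc_binop F)) (\pi_(quot R) x)
      [seq \pi_(quot R) a | a <- s].
Proof.
move=> n_gt1 [_ Fa Fs Fi] [RB [opA opC opI]] x s sz.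
set op := induced_binop _ in opA opC opI *.
have piB a b : \pi_(quot R) (assoc_binop F a b) = op (\pi a) (\pi b).
  by rewrite /op induced_binopE.
set z := F _.
have zE : z = @seq_op {classic X} n F x (x :: s).
  by rewrite -[x :: s]/(val (Tuple sz)) seq_op_tuple.
have xz : assoc_binop F x z = z.
  rewrite zE; exact: (@assoc_binop_absorb {classic X}) (eqP sz).
have zx : assoc_binop F z x = foldl (fun b a => assoc_binop F a b) x (x :: s).
  rewrite zE; exact: (@assoc_binop_foldl {classic X}) (eqP sz).
have pi_foldl y t : \pi_(quot R) (foldl (fun b a => assoc_binop F a b) y t) =
    foldl op (\pi y) [seq \pi a | a <- t].
  by elim: t y => //= a t IH y; rewrite IH piB opC.
(* [z] = [x] * [z] = [z] * [x] = [B(z, x)]. *)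
by rewrite -xz piB opC -piB zx pi_foldl /= opI.
Qed.

Lemma nary_semilattice_congruence (X : Type) (n : nat) (F : n.-tuple X -> X)
    (R : equiv_rel X) :
  1 < n -> symmetric_nary_band F -> semilattice_congruence R (assoc_binop F) ->
  Defs.nary_congruence R F.
Proof.
move=> n_gt1 bF RB s t st; apply/Defs.quotP.
have Est : [seq \pi_(quot R) a | a <- s] = [seq \pi_(quot R) a | a <- t].
  suff /(congr1 val) : map_tuple \pi_(quot R) s = map_tuple \pi_(quot R) t by [].
  by apply: eq_from_tnth => i; rewrite !tnth_map; apply/Defs.quotP/st.
case: s t {st} Est => [[|x s] szs] [[|y t] szt] //=.
  by exfalso; move: n_gt1; rewrite -(eqP szs).
by case=> xy st; rewrite !pi_nary_op // xy st.
Qed.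

Theorem proposition4p4 (n : nat) (X : Type) (F : n.-tuple X -> X)
    (sigma : equiv_rel X) :
  2 <= n ->
  symmetric_nary_band F ->
  least_semilattice_congruence (assoc_binop F) sigma ->
  let Fs : n.-tuple (quot sigma) -> quot sigma :=
    induced_nary F in
  let Bs : quot sigma -> quot sigma -> quot sigma :=
    induced_binop (assoc_binop F) in
  [/\ symmetric_nary_band Fs,
      assoc_binop Fs =2 Bs,
      semilattice Bs
    & nary_extension Bs Fs].
Proof.
move=> n_gt1 bF [scB _] Fs Bs; have [[x0] Fassoc Fsym Fidem] := bF.
have RF := nary_semilattice_congruence n_gt1 bF scB.
have Fs_repr (f : 'I_n -> quot sigma) :
    Fs [tuple f i | i < n] = \pi_(quot sigma) (F [tuple repr (f i) | i < n]).
  congr (\pi_(quot sigma) (F _)).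
  by apply: eq_from_tnth => i; rewrite !(tnth_map, tnth_ord_tuple).
have Fs_pi (f : 'I_n -> X) :
    Fs [tuple \pi_(quot sigma) (f i) | i < n] =
    \pi_(quot sigma) (F [tuple f i | i < n]).
  rewrite -(induced_naryE RF); congr Fs.
  by apply: eq_from_tnth => i; rewrite !(tnth_map, tnth_ord_tuple).
(* The nested expressions are compared through the representatives of their
   arguments; only the inner value has to be replaced by an equivalent one. *)
have nested_pi x i : nested Fs x i = \pi_(quot sigma) (nested F (repr \o x) i).
  rewrite /nested -Fs_pi; congr Fs; apply: eq_from_tnth => j.
  rewrite !tnth_mktuple; case: ifP => _; first by rewrite /= reprK.
  by case: ifP => _; rewrite ?Fs_repr //= reprK.
split; first split.
- by exists; exact: \pi_(quot sigma) x0.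
- by move=> x i lt_i; rewrite !nested_pi Fassoc.
- move=> p t; rewrite Fs_repr; congr (\pi_(quot sigma) _).
  rewrite -[RHS](Fsym p); congr F; apply: eq_from_tnth => i.
  by rewrite !(tnth_map, tnth_ord_tuple).
- by move=> x; rewrite Fs_repr Fidem reprK.
- move=> a b; rewrite /assoc_binop Fs_repr; congr (\pi_(quot sigma) (F _)).
  by apply: eq_from_tnth => i; rewrite !tnth_mktuple; case: ifP.
- by case: scB.
- move=> s t sz.
  have szr : size (repr s :: map repr t) == n by rewrite /= size_map.
  have -> : Fs (Tuple sz) = \pi_(quot sigma) (F (Tuple szr)).
    by congr (\pi_(quot sigma) (F _)); apply: val_inj.
  rewrite pi_nary_op // reprK -map_comp; congr foldl.
  by rewrite -[RHS]map_id; apply: eq_map => a /=; rewrite reprK.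
Qed.
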